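(* For the trace--logarithmic density with frozen scalar $\theta_h>0$, $$T_K=[\operatorname{tr}(\boldsymbol A_K)]^p-\kappa_{\theta_h}\log a_K,\qquad \kappa_{\theta_h}=p\,d^{p-1}\theta_h^p,$$ one has $$\frac{\partial T_K}{\partial\boldsymbol A_K}=p[\operatorname{tr}(\boldsymbol A_K)]^{p-1}\boldsymbol I,\qquad \frac{\partial T_K}{\partial a_K}=-\kappa_{\theta_h}a_K^{-1}.$$ Consequently, $$\boldsymbol Q_K=p[\operatorname{tr}(\boldsymbol A_K)]^{p-1}\boldsymbol A_K-\kappa_{\theta_h}\boldsymbol I,$$ $$\boldsymbol U_K=\boldsymbol J_K\Bigl[p[\operatorname{tr}(\boldsymbol A_K)]^{p-1}\boldsymbol A_K-\Bigl(\tfrac12T_K+\kappa_{\theta_h}\Bigr)\boldsymbol I\Bigr]\boldsymbol J_K^{-1},$$ and in particular $$\mathcal G_K^{\xi}=\frac{\partial G_K}{\partial[\boldsymbol\xi_0^K,\ldots,\boldsymbol\xi_d^K]}=2\rho_K\boldsymbol R\,\widehat E_K^{-1}\Bigl[p[\operatorname{tr}(\boldsymbol A_K)]^{p-1}\boldsymbol A_K-\kappa_{\theta_h}\boldsymbol I\Bigr].$$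
   Context: Let $d\ge2$, $\gamma>1$, $p=d\gamma/2$. For a simplicial physical element $K$ with vertices $\boldsymbol x_0^K,\dots,\boldsymbol x_d^K\in\mathbb R^d$ and corresponding computational vertices $\boldsymbol\xi_0^K,\dots,\boldsymbol\xi_d^K\in\mathbb R^d$ (both nondegenerate, positively oriented), set $E_K=[\boldsymbol x_1^K-\boldsymbol x_0^K,\ldots,\boldsymbol x_d^K-\boldsymbol x_0^K]$, $\widehat E_K=[\boldsymbol\xi_1^K-\boldsymbol\xi_0^K,\ldots,\boldsymbol\xi_d^K-\boldsymbol\xi_0^K]$, $\boldsymbol J_K=E_K\widehat E_K^{-1}$, $\boldsymbol P_K=\boldsymbol J_K^{-1}$. Let $\boldsymbol M_K$ be a symmetric positive-definite element metric, $\rho_K=\sqrt{\det\boldsymbol M_K}$, $\boldsymbol A_K=\boldsymbol P_K\boldsymbol M_K^{-1}\boldsymbol P_K^T$, $a_K=\det\boldsymbol A_K$. $T_K=T(\boldsymbol A_K,a_K)$ is regarded as a function of the two independent arguments $(\boldsymbol A,a)$ when forming $\partial T_K/\partial\boldsymbol A_K$ (the symmetric-Frobenius derivative on symmetric matrices) and $\partial T_K/\partial a_K$; $G_K=\rho_KT_K$. Define $$\boldsymbol Q_K:=\boldsymbol A_K\frac{\partial T_K}{\partial\boldsymbol A_K}+a_K\frac{\partial T_K}{\partial a_K}\boldsymbol I,\qquad \boldsymbol U_K:=\boldsymbol J_K\Bigl(-\tfrac12T_K\boldsymbol I+\boldsymbol Q_K\Bigr)\boldsymbol J_K^{-1}.$$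 $\mathcal G_K^\xi\in\mathbb R^{(d+1)\times d}$ is the row-stacked derivative of $G_K$ with respect to the computational vertices: its row $j$ ($j=0,\dots,d$) is the transpose of $\partial G_K/\partial\boldsymbol\xi_j^K$, taken with $E_K$, $\boldsymbol M_K$ and $\theta_h$ held fixed. $\boldsymbol R\in\mathbb R^{(d+1)\times d}$ is the matrix whose first row is $(-1,\dots,-1)$ and whose remaining $d$ rows form the $d\times d$ identity matrix. *)

(* Defs.v *)
From HB Require Import structures.
From mathcomp Require Import all_boot all_order all_algebra.
From mathcomp Require Import all_classical all_reals all_analysis.
From mathcomp Require Import ring lra.

Set Implicit Arguments.
Unset Strict Implicit.
Unset Printing Implicit Defensive.

Import Order.TTheory GRing.Theory Num.Theory.
Import numFieldNormedType.Exports.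
Local Open Scope classical_set_scope.
Local Open Scope ring_scope.

Section MatrixCalculus.
Variable R : realType.

Definition spdmx (n : nat) (M : 'M[R]_n) : Prop :=
  M^T = M /\ forall v : 'cV[R]_n, v != 0 -> 0 < (v^T *m M *m v) ord0 ord0.

(* D is the Frechet gradient at A of the restriction of F to the space of
   symmetric matrices, for the Frobenius product <D, H> = tr(D^T H); D itself
   is required to be symmetric, which makes it unique. *)
Definition is_symgrad (n : nat) (F : 'M[R]_n -> R) (A D : 'M[R]_n) : Prop :=
  D^T = D /\
  forall e : R, 0 < e ->
    \forall H \near (0 : 'M[R]_n), H^T = H ->
      `|F (A + H) - F A - \tr (D^T *m H)| <= e * `|H|.

Definition symgrad (n : nat) (F : 'M[R]_n -> R) (A : 'M[R]_n) : 'M[R]_n :=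
  xget 0 [set D | is_symgrad F A D].

Lemma is_symgrad_uniq (n : nat) (F : 'M[R]_n -> R) (A D1 D2 : 'M[R]_n) :
  is_symgrad F A D1 -> is_symgrad F A D2 -> D1 = D2.
Proof.
move=> [D1T FD1] [D2T FD2]; pose D := D1 - D2.
have DT : D^T = D by rewrite /D linearB /= D1T D2T.
have key (e : R) : 0 < e -> \tr (D^T *m D) <= (e + e) * `|D|.
  move=> e0; have [r /= r0 Hr] := (nbhs_ballP _ _).1 (filterI (FD1 e e0) (FD2 e e0)).
  pose t := r / 2 / (1 + `|D|).
  have D0 : 0 < 1 + `|D| by rewrite ltr_pwDl.
  have t0 : 0 < t by rewrite !divr_gt0.
  have tT : (t *: D)^T = t *: D by rewrite linearZ /= DT.
  have tB : ball (0 : 'M[R]_n) r (t *: D).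
    rewrite -ball_normE /= sub0r normrN normrZ gtr0_norm // /t.
    rewrite mulrAC ltr_pdivrMr // -mulrA ltr_pM2l //.
    rewrite mulrC ltr_pdivrMr //; lra.
  have [/(_ tT) h1 /(_ tT) h2] := Hr _ tB; clearbody t.
  have : `|\tr (D^T *m (t *: D))| <= (e + e) * `|t *: D|.
    rewrite {1}/D linearB /= mulmxBl raddfB /= -/D mulrDl.
    apply: le_trans (lerD h2 h1); rewrite -[X in _ <= X + _]normrN.
    rewrite (le_trans _ (ler_normD _ _))// le_eqVlt; apply/orP; left.
    rewrite eq_sym -normrN; apply/eqP; congr `|_|; ring.
  rewrite -scalemxAr mxtraceZ normrM normrZ (gtr0_norm t0) mulrCA ler_pM2l //.
  by apply: le_trans; rewrite ler_norm.
have trE : \tr (D^T *m D) = \sum_i \sum_j D j i ^+ 2.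
  apply: eq_bigr => i _; rewrite mxE; apply: eq_bigr => j _.
  by rewrite mxE expr2.
have tr_le0 : \tr (D^T *m D) <= 0.
  apply/ler_addgt0Pl => e e0; rewrite addr0.
  have D0 : 0 < 2 * (1 + `|D|) by rewrite mulr_gt0 // ltr_pwDl.
  apply: le_trans (key (e / (2 * (1 + `|D|))) (divr_gt0 e0 D0)) _.
  rewrite -mulr2n -[X in X * _]mulr_natl mulrA mulrAC ler_pdivrMr //.
  have := normr_ge0 D; nra.
apply/subr0_eq/matrixP => i j; rewrite -/D [RHS]mxE; apply/eqP.
rewrite -sqrf_eq0 eq_le sqr_ge0 andbT; apply: le_trans tr_le0; rewrite trE.
rewrite (bigD1 j) //= (bigD1 i) //= -addrA lerDl addr_ge0 //.
  by apply: sumr_ge0 => k _; exact: sqr_ge0.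
by apply: sumr_ge0 => k _; apply: sumr_ge0 => l _; exact: sqr_ge0.
Qed.

Lemma is_symgradE (n : nat) (F : 'M[R]_n -> R) (A D : 'M[R]_n) :
  is_symgrad F A D -> symgrad F A = D.
Proof.
by move=> FD; apply: xget_unique => // D' FD'; exact: is_symgrad_uniq FD' FD.
Qed.

(* Row j is the transpose of the gradient of F with respect to row j of X. *)
Definition row_gradient (m n : nat) (F : 'M[R]_(m, n) -> R)
    (X : 'M[R]_(m, n)) : 'M[R]_(m, n) :=
  \matrix_(j, k) 'D_(delta_mx j k) F X.

End MatrixCalculus.

(* The d + 1 vertices of a simplex in R^d are stored as the rows of a matrix
   of type 'M_(d.+1, d), so that derivatives with respect to the vertices are
   row-stacked. A density is a function T of the two independent arguments
   (A, a). *)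
Section Element.
Variables (R : realType) (d : nat).
Implicit Types (X Xi : 'M[R]_(d.+1, d)) (E M A : 'M[R]_d).
Implicit Types (T : 'M[R]_d -> R -> R).

(* Column k is the edge vector x_(k+1) - x_0. *)
Definition edge_mx X : 'M[R]_d :=
  \matrix_(i, k) (X (lift ord0 k) i - X ord0 i).

Definition Jmx E Xi : 'M[R]_d := E *m invmx (edge_mx Xi).

Definition Pmx E Xi : 'M[R]_d := invmx (Jmx E Xi).

Definition Amx E M Xi : 'M[R]_d :=
  Pmx E Xi *m invmx M *m (Pmx E Xi)^T.

Definition rho M : R := Num.sqrt (\det M).

Definition TK T E M Xi : R := T (Amx E M Xi) (\det (Amx E M Xi)).

Definition GK T E M Xi : R := rho M * TK T E M Xi.

Definition Qmx T E M Xi : 'M[R]_d :=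
  let A := Amx E M Xi in
  let a := \det A in
  A *m symgrad (fun B => T B a) A + (a * derive1 (T A) a)%:M.

Definition Umx T E M Xi : 'M[R]_d :=
  Jmx E Xi *m (- (2^-1 * TK T E M Xi)%:M + Qmx T E M Xi) *m invmx (Jmx E Xi).

Definition Rmx : 'M[R]_(d.+1, d) :=
  col_mx (const_mx (-1) : 'rV[R]_d) (1%:M : 'M[R]_d).

Definition kappa (p theta : R) : R := p * d%:R `^ (p - 1) * theta `^ p.

Definition trlog (p theta : R) : 'M[R]_d -> R -> R :=
  fun A a => (\tr A) `^ p - kappa p theta * ln a.

End Element.

(* Main.v *)
Require Import Defs.
From HB Require Import structures.
From mathcomp Require Import all_boot all_order all_algebra.
From mathcomp Require Import all_classical all_reals all_analysis.
From mathcomp Require Import ring lra.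
Set Implicit Arguments.
Unset Strict Implicit.
Unset Printing Implicit Defensive.

Import Order.TTheory GRing.Theory Num.Theory.
Import numFieldNormedType.Exports.
Local Open Scope classical_set_scope.
Local Open Scope ring_scope.

(** Near [Xi] the inverse of the computational edge matrix disappears from the
    metric-weighted tensor: with [e := edge_mx Y] and the fixed matrix
    [N := E^-1 *m M^-1 *m E^-T] one has [Amx E M Y = e *m N *m e^T]
    ([Amx_unitE]). On that neighbourhood the density is therefore
    [(\tr (e N e^T)) `^ p - kappa * ln ((\det e) ^ 2 * \det N)], in which the
    trace and the determinant are polynomials in the vertices. Both stay
    positive because [e N e^T] is symmetric positive definite, so the power
    and the logarithm are smooth there and [GK] is Frechet differentiable.

    Once differentiability is known, every gradient is read off along lines
    [t |-> t *: V + Xi]. For a coordinate direction [V] the edge matrix is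
    perturbed by a matrix [H] with a single nonzero row, and Laplace expansion
    along that row makes the determinant affine in [t]:
    [\det (t H + e) = \det e * (1 + t * \tr (e^-1 H))] ([det_row_perturb]).
    The trace is quadratic in [t], with linear coefficient
    [2 * \tr (N e^T H)] ([mxtrace_congr_line]). Since
    [e^-1 (e N e^T) = N e^T], the two contributions combine into
    [2 * \tr (e^-1 (p (\tr A) `^ (p-1) A - kappa I) H)]. Finally
    [edge_mx V = V^T *m Rmx] ([edge_mxE]), so that for the unit perturbation
    of entry [(j, k)] the trace [\tr (B *m H)] is the entry [(j, k)] of
    [Rmx *m B]; this is where the factor [Rmx] of the gradient comes from.

    The symmetric gradient in the matrix argument follows from the same
    principle applied to [B |-> (\tr B) `^ p] ([is_symgrad_differentiable]),
    and the formulas for [Qmx] and [Umx] are then algebra. *)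

(** * Differentiability of matrix-valued maps and directional derivatives *)

Section Differentials.
Context {R : realType} {V : normedModType R}.

(** [GK] is given by a smooth formula only where the edge matrix is invertible;
    this transfers differentiability from that formula to [GK]. *)
Lemma near_eq_differentiable (f g : V -> R) (x : V) :
  (\near x, f x = g x) -> differentiable f x -> differentiable g x.
Proof.
move=> fg df; have [cdf fE] := (diff_locallyP _ _).1 df.
have gE : g \o shift x = cst (g x) + 'd f x +o_ 0 id.
  apply/eqaddoP => e e0; have /eqaddoP/(_ e e0) := fE.
  have fg0 : \forall h \near (0 : V), f (h + x) = g (h + x).
    by move: fg; rewrite (near_shift 0); apply: filterS => h /=; rewrite subr0.
  by apply: filterS2 fg0 => h fgh; rewrite !fctE /= fgh (nbhs_singleton fg).
by apply/diff_locallyP; rewrite (diff_unique cdf gE).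
Qed.

Lemma differentiable_fsum (I : Type) (r : seq I) (F : I -> V -> R) (x : V) :
  (forall i, differentiable (F i) x) ->
  differentiable (fun y => \sum_(i <- r) F i y) x.
Proof.
move=> dF; rewrite (_ : (fun y => _) = \sum_(i <- r) F i); last first.
  by apply/funext => y; rewrite fct_sumE.
by elim/big_ind : _ => // f g; exact: differentiableD.
Qed.

Lemma differentiable_fprod (I : Type) (r : seq I) (F : I -> V -> R) (x : V) :
  (forall i, differentiable (F i) x) ->
  differentiable (fun y => \prod_(i <- r) F i y) x.
Proof.
move=> dF; elim: r => [|i r IH].
  by under eq_fun do rewrite big_nil; exact: differentiable_cst.
by under eq_fun do rewrite big_cons; exact: differentiableM.
Qed.

(** Entrywise, because traces, determinants and products are polynomials in the
    entries: all closure properties reduce to finite sums and products of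
    scalar functions. *)
Definition mx_differentiable m n (F : V -> 'M[R]_(m, n)) (x : V) :=
  forall i j, differentiable (fun y => F y i j) x.

Lemma mx_differentiable_cst m n (A : 'M[R]_(m, n)) (x : V) :
  mx_differentiable (fun=> A) x.
Proof. by move=> i j; exact: differentiable_cst. Qed.

Lemma mx_differentiable_tr m n (F : V -> 'M[R]_(m, n)) (x : V) :
  mx_differentiable F x -> mx_differentiable (fun y => (F y)^T) x.
Proof. by move=> dF i j; under eq_fun do rewrite mxE; exact: dF. Qed.

Lemma mx_differentiableM m n p (F : V -> 'M[R]_(m, n)) (G : V -> 'M[R]_(n, p))
    (x : V) :
  mx_differentiable F x -> mx_differentiable G x ->
  mx_differentiable (fun y => F y *m G y) x.
Proof.
move=> dF dG i j; under eq_fun do rewrite mxE.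
by apply: differentiable_fsum => k; exact: differentiableM.
Qed.

Lemma differentiable_mxtrace n (F : V -> 'M[R]_n) (x : V) :
  mx_differentiable F x -> differentiable (fun y => \tr (F y)) x.
Proof. by move=> dF; exact: differentiable_fsum. Qed.

Lemma differentiable_det n (F : V -> 'M[R]_n) (x : V) :
  mx_differentiable F x -> differentiable (fun y => \det (F y)) x.
Proof.
move=> dF; apply: differentiable_fsum => s.
apply: differentiableM; first exact: differentiable_cst.
exact: differentiable_fprod.
Qed.

Lemma differentiable_powR (p : R) (f : V -> R) (x : V) :
  0 < f x -> differentiable f x -> differentiable (fun y => f y `^ p) x.
Proof.
move=> fx0 df; apply: (@differentiable_comp _ _ _ _ f (@powR R ^~ p)) => //.
by apply/derivable1_diffP; have [] := is_derive1_powR p fx0.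
Qed.

Lemma differentiable_ln (f : V -> R) (x : V) :
  0 < f x -> differentiable f x -> differentiable (fun y => ln (f y)) x.
Proof.
move=> fx0 df; apply: (@differentiable_comp _ _ _ _ f (@ln R)) => //.
by apply/derivable1_diffP; have [] := is_derive1_ln fx0.
Qed.

(** Turns a directional derivative into a one-variable derivative, where the
    chain rule on the real line is available. *)
Lemma derive_lineE (f : V -> R) (x v : V) (df : R) :
  is_derive (0 : R) (1 : R) (fun t : R => f (t *: v + x)) df -> 'D_v f x = df.
Proof.
case=> _ <-; rewrite /derive; set g1 := fun h => h^-1 *: _.
set g2 := fun h => h^-1 *: _; suff -> : g1 = g2 by [].
by apply/funext => h; rewrite /g1 /g2 /= addr0 scale0r add0r [_%:A]mulr1.
Qed.

End Differentials.

(** Differentiability bounds the remainder over all increments [H], in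
    particular over the symmetric ones, so only the differential remains to be
    identified, one direction at a time. *)
Lemma is_symgrad_differentiable (R : realType) (n : nat) (F : 'M[R]_n -> R)
    (A D : 'M[R]_n) :
  D^T = D -> differentiable F A -> (forall H, 'D_H F A = \tr (D^T *m H)) ->
  is_symgrad F A D.
Proof.
move=> DT dF DF; split=> // e e0.
have /eqaddoP/(_ e e0) := diff_locally dF.
apply: filterS => H /= HF _.
by move: HF; rewrite !fctE /= -deriveE // DF opprD addrA (addrC A H).
Qed.

(** * Positive definite matrices *)

Section DeterminantPositivity.
Context {R : realType} {n : nat}.
Implicit Types (M : 'M[R]_n) (v : 'cV[R]_n).

Lemma spdmx1 : spdmx (1%:M : 'M[R]_n).
Proof.
split=> [|v v0]; first exact: trmx1.
rewrite mulmx1 mxE; under eq_bigr do rewrite mxE -expr2.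
have [i vi] : exists i, v i 0 != 0 by exact/cV0Pn.
rewrite (bigD1 i) //= ltr_pwDl ?exprn_even_gt0 //.
by apply: sumr_ge0 => j _; exact: sqr_ge0.
Qed.

Lemma spdmx_convex M N (t : R) : spdmx M -> spdmx N -> 0 <= t <= 1 ->
  spdmx ((1 - t) *: M + t *: N).
Proof.
move=> [MT M0] [NT N0] /andP[t0 t1]; split=> [|v v0].
  by rewrite linearD !linearZ /= MT NT.
rewrite mulmxDr mulmxDl -!scalemxAr -!scalemxAl !mxE.
by have := M0 _ v0; have := N0 _ v0; rewrite !mxE; nra.
Qed.

Lemma spdmx_unit M : spdmx M -> M \in unitmx.
Proof.
move=> [MT M0]; rewrite unitmxE unitfE; apply/det0P => -[w w0 wM].
have := M0 w^T; rewrite trmxK wM mul0mx mxE ltxx -(inj_eq (@trmx_inj _ _ _)).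
by rewrite trmxK trmx0 => /(_ w0).
Qed.

(** The segment from [M] to the identity consists of positive definite, hence
    invertible, matrices. Along it the determinant is a polynomial in the
    parameter without root in [0, 1], and it equals 1 at the identity, so it is
    positive at [M] by the intermediate value theorem for polynomials. *)
Lemma spdmx_det_gt0 M : spdmx M -> 0 < \det M.
Proof.
move=> hM; rewrite ltNge; apply/negP => Mle0.
pose p : {poly R} := \det ((1 - 'X) *: map_mx polyC M + 'X *: 1%:M).
have pE t : p.[t] = \det ((1 - t) *: M + t *: 1%:M).
  rewrite -[LHS]/(horner_eval t p) -det_map_mx; congr (\det _).
  apply/matrixP => i j; rewrite !mxE /= /horner_eval !hornerE.
  by case: eqP => _; rewrite ?mulr0n ?mulr1n !(hornerE, hornerMn).
have [t] : exists2 t, 0 <= t <= 1 & root p t.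
  apply: poly_ivt => //; rewrite !pE subr0 scale1r scale0r addr0 Mle0 /=.
  by rewrite subrr scale0r add0r scale1r det1 ler01.
move=> t01 /rootP; rewrite pE => pt0.
have := spdmx_unit (spdmx_convex hM spdmx1 t01).
by rewrite unitmxE pt0 unitr0.
Qed.

Lemma spdmx_inv M : spdmx M -> spdmx (invmx M).
Proof.
move=> hM; have uM := spdmx_unit hM; case: hM => MT M0.
split=> [|v v0]; first by rewrite trmx_inv MT.
have w0 : invmx M *m v != 0.
  by apply: contra v0 => /eqP w0; rewrite -[v](mulKVmx uM) w0 mulmx0.
have := M0 _ w0; rewrite trmx_mul trmx_inv MT -!mulmxA.
by rewrite (mulKVmx uM).
Qed.

Lemma spdmx_congr (P M : 'M[R]_n) : P \in unitmx -> spdmx M ->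
  spdmx (P *m M *m P^T).
Proof.
move=> uP [MT M0]; split=> [|v v0].
  by rewrite !trmx_mul trmxK MT mulmxA.
have w0 : P^T *m v != 0.
  apply: contra v0 => /eqP w0; rewrite -unitmx_tr in uP.
  by rewrite -[v](mulKmx uP) w0 mulmx0.
by have := M0 _ w0; rewrite trmx_mul trmxK !mulmxA.
Qed.

Lemma spdmx_trace_gt0 M : (0 < n)%N -> spdmx M -> 0 < \tr M.
Proof.
move=> n0 [_ M0]; have Mii i : 0 < M i i.
  have e0 : delta_mx i 0 != 0 :> 'cV[R]_n.
    by apply/cV0Pn; exists i; rewrite mxE !eqxx oner_neq0.
  by have := M0 _ e0; rewrite trmx_delta -rowE -colE !mxE.
rewrite /mxtrace (bigD1 (Ordinal n0)) //= ltr_pwDl //.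
by apply: sumr_ge0 => i _; exact: ltW.
Qed.

End DeterminantPositivity.

(** * One-row perturbations of determinants *)

(** The case of Jacobi's formula where the perturbation lives in one row; there
    it is exact rather than first-order, by multilinearity. The coefficient of
    [t] is the determinant of [E] with row [k] replaced by that of [H]; its
    cofactors along row [k] are those of [E], that is, [\det E] times column
    [k] of the inverse. *)
Lemma det_row_perturb (R : realType) n (E H : 'M[R]_n) (k : 'I_n) (t : R) :
  E \in unitmx -> row' k H = 0 ->
  \det (t *: H + E) = \det E * (1 + t * \tr (invmx E *m H)).
Proof.
move=> uE Hk.
pose C : 'M[R]_n := \matrix_(i, j) (if i == k then H i j else E i j).
have H0 i j : i != k -> H i j = 0.
  rewrite eq_sym => /unlift_some [i' -> _].
  by have /matrixP/(_ i' j) := Hk; rewrite !mxE.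
have cofC j : cofactor C k j = cofactor E k j.
  rewrite /cofactor; congr (_ * \det _); apply/matrixP => a b.
  by rewrite !mxE eq_sym (negPf (neq_lift _ _)).
have CE : \det C = \det E * \tr (invmx E *m H).
  rewrite (expand_det_row _ k) mulr_sumr; apply: eq_bigr => j _.
  rewrite cofC [C k j]mxE eqxx mxE (bigD1 k) //= [X in _ + X]big1 ?addr0.
    by rewrite /invmx uE 2!mxE -mulrA mulVKf -?unitfE // mulrC.
  by move=> i /H0 ->; rewrite mulr0.
rewrite (determinant_multilinear (B := E) (C := C) (i0 := k) (b := 1) (c := t)).
- by rewrite CE; ring.
- by apply/rowP => j; rewrite !mxE eqxx mul1r addrC.
- apply/matrixP => i j.
  by rewrite !mxE H0 ?mulr0 ?add0r // eq_sym neq_lift.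
- apply/matrixP => i j.
  by rewrite !mxE H0 ?mulr0 ?add0r // eq_sym ?neq_lift //
    (negPf (neq_lift _ _)).
Qed.

(** * Edge matrices of simplices *)

Section Simplex.
Variables (R : realType) (d : nat).
Implicit Types (X V : 'M[R]_(d.+1, d)) (E H N M B : 'M[R]_d).

Lemma edge_mxE X : edge_mx X = X^T *m Rmx R d.
Proof.
have R0 k : Rmx R d ord0 k = -1.
  have -> : ord0 = lshift d (ord0 : 'I_1) :> 'I_(1 + d) by exact: val_inj.
  by rewrite [LHS]col_mxEu mxE.
have RS j k : Rmx R d (lift ord0 j) k = (j == k)%:R.
  have -> : lift ord0 j = rshift 1 j :> 'I_(1 + d) by exact: val_inj.
  by rewrite [LHS]col_mxEd mxE.
apply/matrixP => i k; rewrite [LHS]mxE [RHS]mxE big_ord_recl R0 mxE mulrN1.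
rewrite [RHS]addrC; congr (_ - _).
rewrite (bigD1 k) //= big1 => [|j jk]; last by rewrite RS (negPf jk) mulr0.
by rewrite RS eqxx mulr1 addr0 mxE.
Qed.

Lemma mx_differentiable_edge X : mx_differentiable (@edge_mx R d) X.
Proof.
move=> i k; under eq_fun do rewrite mxE.
by apply: differentiableB; exact: differentiable_coord.
Qed.

(** With [edge_mxE], cyclicity of the trace gives
    [\tr (B V^T Rmx) = \tr (V^T (Rmx B))], the Frobenius pairing of [V] with
    [Rmx B]. *)
Lemma mxtrace_edge_delta B (j : 'I_d.+1) (k : 'I_d) :
  \tr (B *m edge_mx (delta_mx j k)) = (Rmx R d *m B) j k.
Proof.
rewrite edge_mxE mxtrace_mulC -mulmxA trmx_delta /mxtrace.
rewrite (bigD1 k) //= big1 => [|i ik]; rewrite mxE (bigD1 j) //= big1.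
- by rewrite mxE !eqxx mul1r !addr0.
- by move=> l lj; rewrite mxE (negPf lj) andbF mul0r.
- by rewrite mxE (negPf ik) mul0r addr0.
- by move=> l lj; rewrite mxE (negPf lj) andbF mul0r.
Qed.

Lemma row'_edge_delta (j : 'I_d.+1) (k : 'I_d) :
  row' k (edge_mx (delta_mx j k) : 'M[R]_d) = 0.
Proof.
apply/matrixP => i l; rewrite !mxE eq_sym [lift k i == k]eq_sym.
by rewrite (negPf (neq_lift _ _)) !andbF subrr.
Qed.

(** The two mixed products of the expansion are transposes of each other, as
    [N] is symmetric; hence the factor 2. *)
Lemma mxtrace_congr_line E H N (t : R) : N^T = N ->
  \tr ((t *: H + E) *m N *m (t *: H + E)^T) =
  \tr (E *m N *m E^T) + t * (2 * \tr (N *m E^T *m H)) +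
  t ^+ 2 * \tr (H *m N *m H^T).
Proof.
move=> NT; rewrite linearD linearZ /= !mulmxDl !mulmxDr.
rewrite -!scalemxAl -!scalemxAr !linearD !linearZ /=.
have -> : \tr (E *m N *m H^T) = \tr (N *m E^T *m H).
  by rewrite -mxtrace_tr !trmx_mul trmxK NT mulmxA mxtrace_mulC mulmxA
    mxtrace_mulC mulmxA.
have -> : \tr (H *m N *m E^T) = \tr (N *m E^T *m H).
  by rewrite -mulmxA mxtrace_mulC.
by ring.
Qed.

(** Isolates the dependence on the computational vertices: the inverse of
    [edge_mx X] inside the Jacobian is undone by the inversion in [Pmx]. *)
Lemma Amx_unitE E M X : E \in unitmx -> edge_mx X \in unitmx ->
  Amx E M X =
  edge_mx X *m (invmx E *m invmx M *m (invmx E)^T) *m (edge_mx X)^T.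
Proof.
move=> uE uX; rewrite /Amx; have -> : Pmx E X = edge_mx X *m invmx E.
  have uJ : Jmx E X \in unitmx by rewrite unitmx_mul uE unitmx_inv.
  rewrite -[RHS](mulKmx uJ) -/(Pmx E X) [Jmx E X *m _]mulmxA mulmxKV //.
  by rewrite mulmxV // mulmx1.
by rewrite trmx_mul !mulmxA.
Qed.

End Simplex.

(** * The trace-logarithmic density *)

(** The density along a line: [s + t b + t^2 c] is the trace and
    [a (1 + t tau)^2] the determinant of [e N e^T] when one row of [e] moves. *)
Lemma is_derive_trlog_line (R : realType) (p kap s b c a tau : R) :
  0 < s -> 0 < a ->
  is_derive (0 : R) (1 : R)
    (fun t : R => (s + t * b + t ^+ 2 * c) `^ p -
      kap * ln (a * (1 + t * tau) ^+ 2))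
    (p * s `^ (p - 1) * b - kap * (2 * tau)).
Proof.
move=> s0 a0; pose q (t : R) := s + t * b + t ^+ 2 * c.
pose l (t : R) := a * (1 + t * tau) ^+ 2.
have dq : is_derive (0 : R) (1 : R) q b.
  by apply: is_derive_eq; rewrite !scaler0 /GRing.scale /=; ring.
have dl : is_derive (0 : R) (1 : R) l (a * (2 * tau)).
  by apply: is_derive_eq; rewrite /GRing.scale /=; ring.
have q0 : q 0 = s by rewrite /q; ring.
have l0 : l 0 = a by rewrite /l; ring.
have dqp : is_derive (0 : R) (1 : R) (@powR R ^~ p \o q) (p * s `^ (p - 1) * b).
  by apply: is_derive1_comp; rewrite q0; exact: is_derive1_powR.
have dll : is_derive (0 : R) (1 : R) (@ln R \o l) (a^-1 * (a * (2 * tau))).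
  by apply: is_derive1_comp; rewrite l0; exact: is_derive1_ln.
have := is_deriveB dqp (is_deriveZ kap dll).
by rewrite mulKf ?gt_eqF.
Qed.

Section TraceLog.
Variables (R : realType) (d : nat).
Implicit Types (X : 'M[R]_(d.+1, d)) (E A M : 'M[R]_d) (p theta a : R).

Lemma is_symgrad_trlog p theta a A : 0 < \tr A ->
  is_symgrad (fun B => trlog p theta B a) A (p * \tr A `^ (p - 1))%:M.
Proof.
move=> A0; have dtr : mx_differentiable (fun B : 'M[R]_d => B) A.
  by move=> i j; exact: differentiable_coord.
apply: is_symgrad_differentiable; first exact: tr_scalar_mx.
  apply: differentiableB; last exact: differentiable_cst.
  exact/differentiable_powR/differentiable_mxtrace.
move=> H; rewrite tr_scalar_mx mul_scalar_mx linearZ /=; apply: derive_lineE.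
pose q (t : R) := t * \tr H + \tr A.
have dq : is_derive (0 : R) (1 : R) q (\tr H).
  by apply: is_derive_eq; rewrite /GRing.scale /=; ring.
have dqp : is_derive (0 : R) (1 : R) (@powR R ^~ p \o q)
    (p * (\tr A) `^ (p - 1) * \tr H).
  have -> : \tr A = q 0 by rewrite /q mul0r add0r.
  by apply: is_derive1_comp; apply: is_derive1_powR; rewrite /q mul0r add0r.
have := is_deriveB dqp (is_derive_cst (kappa d p theta * ln a) (0 : R) (1 : R)).
rewrite subr0; congr (is_derive _ _ _ _); apply/funext => t.
by rewrite !fctE /= /trlog [in RHS]linearD [in RHS]linearZ.
Qed.

Lemma is_derive_trlog p theta A a : 0 < a ->
  is_derive a 1 (trlog p theta A) (- kappa d p theta * a^-1).
Proof.
move=> a0; have dln := is_derive1_ln a0.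
rewrite mulNr -[X in is_derive _ _ _ X]sub0r.
exact: (is_deriveB (is_derive_cst _ _ _) (is_deriveZ _ dln)).
Qed.

Variables (E M : 'M[R]_d).
Hypotheses (uE : E \in unitmx) (hM : spdmx M).

(** The physical metric pulled back by the physical edge matrix; it is constant
    when the computational vertices move. *)
Let N := invmx E *m invmx M *m (invmx E)^T.

Lemma pullback_spd : spdmx N.
Proof. by apply: spdmx_congr; [rewrite unitmx_inv|exact: spdmx_inv]. Qed.

Lemma Amx_spd X : edge_mx X \in unitmx -> spdmx (Amx E M X).
Proof.
move=> uX; rewrite Amx_unitE //; apply: spdmx_congr => //.
exact: pullback_spd.
Qed.

(** The smooth formula that agrees with [GK] wherever the edge matrix is
    invertible. *)
Let F p theta X :=
  let A := edge_mx X *m N *m (edge_mx X)^T in rho M * trlog p theta A (\det A).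

Lemma near_GK_trlog p theta X : edge_mx X \in unitmx ->
  \near X, F p theta X = GK (@trlog R d p theta) E M X.
Proof.
move=> uX; have cX : {for X, continuous (fun Y => \det (@edge_mx R d Y))}.
  apply: differentiable_continuous; apply: differentiable_det.
  exact: mx_differentiable_edge.
have : \forall Y \near X, \det (edge_mx Y) != 0.
  by apply: (cvgr_neq0 (\det (edge_mx X)) cX); rewrite -unitfE -unitmxE.
by apply: filterS => Y uY; rewrite /GK /TK Amx_unitE // unitmxE unitfE.
Qed.

Lemma differentiable_GK_trlog p theta X : (0 < d)%N -> edge_mx X \in unitmx ->
  differentiable (GK (@trlog R d p theta) E M) X.
Proof.
move=> d0 uX; apply: near_eq_differentiable (near_GK_trlog p theta uX) _.
have hA := spdmx_congr uX pullback_spd.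
have dA : mx_differentiable (fun Y => edge_mx Y *m N *m (edge_mx Y)^T) X.
  apply: mx_differentiableM;
    last exact/mx_differentiable_tr/mx_differentiable_edge.
  apply: mx_differentiableM; first exact: mx_differentiable_edge.
  exact: mx_differentiable_cst.
apply: differentiableM; first exact: differentiable_cst.
apply: differentiableB.
  apply: differentiable_powR; first exact: spdmx_trace_gt0.
  exact: differentiable_mxtrace.
apply: differentiableM; first exact: differentiable_cst.
by apply: differentiable_ln; [exact: spdmx_det_gt0|exact: differentiable_det].
Qed.

Lemma row_gradient_GK_trlog p theta X : (0 < d)%N -> edge_mx X \in unitmx ->
  row_gradient (GK (@trlog R d p theta) E M) X =
  (2 * rho M) *: (Rmx R d *m invmx (edge_mx X) *m
    ((p * \tr (Amx E M X) `^ (p - 1)) *: Amx E M X - (kappa d p theta)%:M)).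
Proof.
move=> d0 uX; set kap := kappa d p theta; set A := Amx E M X.
set e := edge_mx X.
have hN := pullback_spd; have hA : spdmx A := Amx_spd uX.
have AE : A = e *m N *m e^T by rewrite /A Amx_unitE.
set w := p * _; apply/matrixP => j k; rewrite mxE.
rewrite -(near_eq_derive _ (near_GK_trlog p theta uX)); apply: derive_lineE.
set H : 'M[R]_d := edge_mx (delta_mx j k).
pose tau := \tr (invmx e *m H); pose b := 2 * \tr (N *m e^T *m H).
have := is_derive_trlog_line p kap b (\tr (H *m N *m H^T)) tau
  (spdmx_trace_gt0 d0 hA) (spdmx_det_gt0 hA).
move=> /(is_deriveZ (rho M)).
have -> : rho M *: (p * \tr A `^ (p - 1) * b - kap * (2 * tau)) =
    ((2 * rho M) *: (Rmx R d *m invmx e *m (w *: A - kap%:M))) j k.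
  (* this identity merges the trace and determinant contributions under e^-1 *)
  have eA : invmx e *m A = N *m e^T by rewrite AE -!mulmxA mulKmx.
  rewrite [RHS]mxE -mulmxA -mxtrace_edge_delta -/H mulmxBr mulmxBl.
  rewrite [in RHS]raddfB /= mul_mx_scalar -scalemxAr eA -!scalemxAl !mxtraceZ
    -/tau /b /w.
  by rewrite !/GRing.scale /=; ring.
congr (is_derive _ _ _ _); apply/funext => t.
rewrite /= /F /trlog; congr (rho M * _).
have -> : edge_mx (t *: delta_mx j k + X) = t *: H + e.
  by rewrite /H /e !edge_mxE linearD linearZ /= mulmxDl -scalemxAl.
rewrite mxtrace_congr_line ?hN.1 // -AE; congr (_ - _ * ln _).
rewrite AE !det_mulmx !det_tr
  (det_row_perturb t uX (row'_edge_delta R j k)) -/H -/tau.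
by ring.
Qed.

End TraceLog.

Theorem corollary4p4 (R : realType) (d : nat) (hd : (2 <= d)%N)
    (gamma theta : R) (hgamma : 1 < gamma) (htheta : 0 < theta)
    (X Xi : 'M[R]_(d.+1, d))
    (hX : 0 < \det (edge_mx X)) (hXi : 0 < \det (edge_mx Xi))
    (M : 'M[R]_d) (hM : spdmx M) :
  let p : R := d%:R * gamma / 2 in
  let kap : R := kappa d p theta in
  let T : 'M[R]_d -> R -> R := trlog p theta in
  let E : 'M[R]_d := edge_mx X in
  let J : 'M[R]_d := Jmx E Xi in
  let A : 'M[R]_d := Amx E M Xi in
  let a : R := \det A in
  [/\ is_symgrad (fun B : 'M[R]_d => T B a) A (p * (\tr A) `^ (p - 1))%:M,
      is_derive a 1 (T A) (- kap * a^-1),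
      Qmx T E M Xi = (p * (\tr A) `^ (p - 1)) *: A - kap%:M,
      Umx T E M Xi =
        J *m ((p * (\tr A) `^ (p - 1)) *: A
              - (2^-1 * TK T E M Xi + kap)%:M) *m invmx J &
      differentiable (GK T E M) Xi /\
      row_gradient (GK T E M) Xi =
        (2 * rho M) *: (Rmx R d *m invmx (edge_mx Xi)
                        *m ((p * (\tr A) `^ (p - 1)) *: A - kap%:M))].
Proof.
move=> p kap T E J A a; have d0 : (0 < d)%N := ltnW hd.
have uE : E \in unitmx by rewrite unitmxE unitfE gt_eqF.
have uXi : edge_mx Xi \in unitmx by rewrite unitmxE unitfE gt_eqF.
have hA : spdmx A := Amx_spd uE hM uXi; have a0 : 0 < a := spdmx_det_gt0 hA.
have dTA : is_symgrad (fun B => T B a) A (p * (\tr A) `^ (p - 1))%:M.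
  exact/is_symgrad_trlog/spdmx_trace_gt0.
have dTa : is_derive a 1 (T A) (- kap * a^-1) := is_derive_trlog p theta A a0.
have QE : Qmx T E M Xi = (p * (\tr A) `^ (p - 1)) *: A - kap%:M.
  rewrite /Qmx -/A -/a (is_symgradE dTA) derive1E derive_val mul_mx_scalar.
  by rewrite mulrCA mulfV ?gt_eqF // mulr1 raddfN.
split=> //.
  by rewrite /Umx QE [(_ + kap)%:M]raddfD opprD addrCA.
split; first exact: differentiable_GK_trlog.
exact: row_gradient_GK_trlog.
Qed.
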